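(* Let $\{S_{\alpha,\theta}(t)\}_{t\ge0}$ be the tempered incomplete gamma (TInG) subordinator with parameters $\alpha$ and $\theta>0$, and let $p\in(0,1]$. Then the fractional moment of order $p$ of $\{S_{\alpha,\theta}(t)\}_{t\ge0}$ exists, is finite for $p<\alpha$, and its asymptotic behaviour is given by $$\mathbb{E}[S_{\alpha,\theta}(t)]^{p}\sim\left(\alpha e^{-\theta}\theta^{\alpha-1}t\right)^{p}\qquad\text{as } t\to\infty.$$
   Context: The lower incomplete gamma function is $\gamma(\alpha;\eta)=\int_0^\eta e^{-y}y^{\alpha-1}\,dy$. The tempered incomplete gamma (TInG) subordinator $\{S_{\alpha,\theta}(t)\}_{t\ge0}$, $0<\alpha\le1$, $\theta>0$, is the non-decreasing Lévy process with $\mathbb{E}[e^{-\eta S_{\alpha,\theta}(t)}]=\exp\left(-t\alpha\left(\gamma(\alpha;\eta+\theta)-\gamma(\alpha;\theta)\right)\right)$, $\eta>0$. The notation $\mathbb{E}[X]^p$ means $\mathbb{E}[X^p]$, the $p$-th order moment, and $g\sim h$ means that the ratio $g/h$ tends to $1$ in the indicated limit. *)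

(* Defs.v *)
From mathcomp Require Import all_boot all_order all_algebra.
From mathcomp Require Import all_classical all_reals all_analysis.
Import numFieldNormedType.Exports.
Set Implicit Arguments.
Unset Strict Implicit.
Unset Printing Implicit Defensive.
Import Order.TTheory GRing.Theory Num.Theory.

Local Open Scope classical_set_scope.
Local Open Scope ring_scope.

(* The value of the integrand at 0 is irrelevant, {0} being negligible;
   the integral is finite for 0 < alpha. *)
Definition lower_incomplete_gamma (R : realType) (alpha eta : R) : R :=
  \int[lebesgue_measure]_(y in `[0, eta]) (expR (- y) * y `^ (alpha - 1)).

(* Since each B i may be setT, the product rule for the whole family gives it
   for all subfamilies. *)
Definition mutually_independent d (T : measurableType d) (R : realType)
    (P : probability T R) (n : nat) (X : 'I_n -> T -> R) : Prop :=
  forall B : 'I_n -> set R, (forall i, measurable (B i)) ->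
    P (\bigcap_(i in [set: 'I_n]) (X i @^-1` B i)) =
    (\prod_(i < n) P (X i @^-1` B i))%E.

(* A process indexed by [0, +oo[ is represented by a family indexed by R of
   which only the members of nonnegative index matter. *)
Record Levy_process d (T : measurableType d) (R : realType)
    (P : probability T R) (S : R -> {RV P >-> R}) : Prop := {
  Levy_start0 : {ae P, forall w, S 0 w = 0} ;
  Levy_independent_increments : forall (n : nat) (t : nat -> R),
    0 <= t 0%N -> (forall i, t i <= t i.+1) ->
    mutually_independent P (fun i : 'I_n => S (t i.+1) \- S (t i)) ;
  Levy_stationary_increments : forall (s t : R) (B : set R),
    0 <= s -> 0 <= t -> measurable B ->
    P ((S (s + t) \- S s) @^-1` B) = P (S t @^-1` B) ;
  Levy_stochastically_continuous : forall t e : R, 0 <= t -> 0 < e ->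
    P [set w | e < `|S s w - S t w|] @[s --> within [set s | 0 <= s] (nbhs t)]
      --> 0%E ;
  Levy_cadlag : {ae P, forall w, forall t : R, 0 <= t ->
    (S s w @[s --> t^'+] --> S t w) /\
    (0 < t -> cvg (S s w @[s --> t^'-]))} }.

Record subordinator d (T : measurableType d) (R : realType)
    (P : probability T R) (S : R -> {RV P >-> R}) : Prop := {
  subordinator_Levy : Levy_process S ;
  subordinator_nondecreasing :
    {ae P, forall w, forall s t : R, 0 <= s -> s <= t -> S s w <= S t w} }.

Record TInG_subordinator d (T : measurableType d) (R : realType)
    (P : probability T R) (alpha theta : R) (S : R -> {RV P >-> R}) : Prop := {
  TInG_subordinator_subordinator : subordinator S ;
  TInG_Laplace : forall t eta : R, 0 <= t -> 0 < eta ->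
    ('E_P[fun w => expR (- eta * S t w)%R] =
     (expR (- t * (alpha * (lower_incomplete_gamma alpha (eta + theta) -
                            lower_incomplete_gamma alpha theta))))%:E)%E }.

(* 'E_P[X] is always defined as an integral in \bar R; it is a genuine (possibly
   infinite) expectation when X is measurable and E[X^+], E[X^-] are not both
   infinite. *)
Definition expectation_exists d (T : measurableType d) (R : realType)
    (P : probability T R) (X : T -> R) : Prop :=
  measurable_fun setT X /\ ('E_P[(X^\+)%R] < +oo \/ 'E_P[(X^\-)%R] < +oo)%E.

Definition asymp_equiv (R : realType) (I : Type) (F : set_system I)
    (g h : I -> \bar R) : Prop :=
  (g x / h x)%E @[x --> F] --> 1%E.

(* Main.v *)
Require Import Defs.
From mathcomp Require Import all_boot all_order all_algebra.
From mathcomp Require Import all_classical all_reals all_analysis.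
From mathcomp Require Import measurable_realfun ring lra.
Import Order.TTheory GRing.Theory Num.Theory.
Import numFieldNormedType.Exports.
Local Open Scope classical_set_scope.
Local Open Scope ring_scope.

(* With f y = e^-y y^(alpha-1), which is nonincreasing as alpha <= 1, the Laplace
   exponent phi satisfies alpha f(theta + e) e <= phi e <= c e, where
   c = alpha f(theta).
   Upper bound: E[S / (1 + e S)] <= (1 - E[exp(-e S)]) / e <= c t; letting e tend
   to 0 gives E[S t] <= c t, and the concavity of the power (its tangent at c t)
   gives E[S^p] <= (c t)^p.
   Lower bound: for b = (1 - delta) c t, the Chernoff-type inequality
   b^p <= S^p + b^p exp(e (b - S)) with e of order 1 / t bounds E[S^p] below by
   (c t)^p (1 - 2 delta) for t large. *)

(** * Integrability and increments of the lower incomplete gamma function *)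

Lemma powR_continuous (R : realType) (b y : R) :
  0 < y -> {for y, continuous (@powR R ^~ b)}.
Proof.
move=> y0; apply: differentiable_continuous; apply/derivable1_diffP.
by case: (@is_derive1_powR R b y y0).
Qed.

Lemma integral_powR_le (R : realType) (a e x : R) : 0 < a -> 0 < e -> e < x ->
  (\int[lebesgue_measure]_(y in `[e, x]) (y `^ (a - 1))%:E <=
   (x `^ a / a)%:E)%E.
Proof.
move=> a0 e0 ex; have x0 := lt_trans e0 ex.
have dF (y : R) : 0 < y -> is_derive y 1 (fun y => y `^ a / a) (y `^ (a - 1)).
  move=> y0.
  have -> : (fun y : R => y `^ a / a) = a^-1 \*: (@powR R ^~ a).
    by apply/funext => z /=; rewrite /GRing.scale/= mulrC.
  have := is_deriveZ a^-1 (@is_derive1_powR R a y y0).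
  by rewrite scalerA mulVf ?gt_eqF// scale1r.
have cF (y : R) : 0 < y -> {for y, continuous (fun y => y `^ a / a)}.
  by move=> y0; apply: cvgMl; exact: powR_continuous.
rewrite (@continuous_FTC2 _ _ (fun y => y `^ a / a))//.
- by rewrite -EFinB lee_fin gerBl divr_ge0 ?powR_ge0 ?ltW.
- apply: continuous_in_subspaceT => y /set_mem/=; rewrite in_itv/= => /andP[ey _].
  by apply: powR_continuous; exact: lt_le_trans ey.
- split.
  + by move=> y; rewrite in_itv/= => /andP[/(lt_trans e0)/dF[]].
  + exact/cvg_at_right_filter/cF.
  + exact/cvg_at_left_filter/cF.
- move=> y; rewrite in_itv/= => /andP[/(lt_trans e0) y0 _].
  by rewrite derive1E; case: (dF _ y0).
Qed.

Lemma lower_incomplete_gamma_integrable (R : realType) (a x : R) : 0 < a -> 0 < x ->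
  lebesgue_measure.-integrable `[0, x]
    (EFin \o (fun y : R => expR (- y) * y `^ (a - 1))).
Proof.
move=> a0 x0.
have mp : measurable_fun [set: R] (EFin \o (fun y => y `^ (a - 1))).
  by apply/measurable_EFinP; exact: measurable_powR.
have ipow : (\int[lebesgue_measure]_(y in `[0%R, x]) (y `^ (a - 1))%:E <=
   (x `^ a / a)%:E)%E.
  rewrite -integral_itv_obnd_cbnd; last exact: measurable_funTS.
  (* The shift [n.+2] keeps the left endpoint strictly below [x] already for [n = 0]. *)
  pose F n := `[x / n.+2%:R, x]%classic.
  have FE : \bigcup_n F n = `]0, x]%classic.
    apply/seteqP; split => y.
      move=> [n _]; rewrite /F/= !in_itv/= => /andP[+ ->]; rewrite andbT.
      by apply: lt_le_trans; rewrite divr_gt0.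
    rewrite /= in_itv/= => /andP[y0 yx].
    exists (Num.truncn (x / y)) => //; rewrite /F/= in_itv/= yx andbT.
    rewrite ler_pdivrMr// mulrC -ler_pdivrMr// ltW//.
    by rewrite (lt_le_trans (truncnS_gt _))// ler_nat.
  rewrite -FE.
  have nd : nondecreasing_seq F.
    move=> m n mn; rewrite subsetEset => y; rewrite /F/= !in_itv/= => /andP[+ ->].
    rewrite andbT; apply: le_trans.
    by rewrite ler_pM2l// lef_pV2 ?posrE// ler_nat !ltnS.
  have Fcvg : (\int[lebesgue_measure]_(y in F n) (y `^ (a - 1))%:E @[n --> \oo] -->
      \int[lebesgue_measure]_(y in \bigcup_n F n) (y `^ (a - 1))%:E)%E.
    apply: ge0_nondecreasing_set_cvg_integral => //.
    - by move=> n; exact: measurable_itv.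
    - by move=> n; exact: measurable_funTS.
    - by move=> n y _; rewrite lee_fin powR_ge0.
  rewrite -(cvg_lim _ Fcvg)//; apply: lime_le; first exact: cvgP Fcvg.
  apply: nearW => n; apply: integral_powR_le => //; first by rewrite divr_gt0.
  by rewrite ltr_pdivrMr// ltr_pMr// ltr1n.
have mf : measurable_fun [set: R] (fun y => expR (- y) * y `^ (a - 1)).
  apply: measurable_funM; last exact: measurable_powR.
  by apply: measurableT_comp; [exact: measurable_expR|exact: oppr_measurable].
apply/integrableP; split; first exact/measurable_funTS/measurable_EFinP.
apply: le_lt_trans (le_lt_trans ipow (ltry _)).
apply: ge0_le_integral => //=.
- by apply/measurable_funTS/measurable_EFinP; exact: measurableT_comp mf.
- exact: measurable_funTS.
- move=> y; rewrite in_itv/= => /andP[y0 _].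
  rewrite lee_fin ger0_norm ?mulr_ge0 ?powR_ge0 ?expR_ge0//.
  by rewrite ler_piMl ?powR_ge0 ?expR_le1 ?oppr_le0.
Qed.

(** The difference is the integral of a nonincreasing function over []x, x + h]], an interval of
    length [h]; the bounds are its values at the two endpoints times [h]. *)
Lemma lower_incomplete_gamma_increment (R : realType) (a x h : R) :
  0 < a -> a <= 1 -> 0 < x -> 0 < h ->
  expR (- (x + h)) * (x + h) `^ (a - 1) * h <=
    lower_incomplete_gamma a (h + x) - lower_incomplete_gamma a x <=
  expR (- x) * x `^ (a - 1) * h.
Proof.
move=> a0 a1 x0 h0; rewrite (addrC h).
have xh0 : 0 < x + h by lra.
have iI := @lower_incomplete_gamma_integrable R a (x + h) a0 xh0.
rewrite /lower_incomplete_gamma Rintegral_itvB//; last 2 first.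
- by rewrite bnd_simp ltW.
- by rewrite bnd_simp lerDl ltW.
set f := fun y : R => expR (- y) * y `^ (a - 1).
have f_le (y z : R) : 0 < y -> y <= z -> f z <= f y.
  move=> y0 yz; apply: ler_pM; rewrite ?expR_ge0 ?powR_ge0// ?ler_expR ?lerN2//.
  (* As [a <= 1], the power is the inverse of one with the nonnegative exponent [1 - a], which is
     nondecreasing. *)
  rewrite -(opprB 1 a) !powRN lef_pV2 ?posrE ?powR_gt0 ?(lt_le_trans y0)//.
  by rewrite ge0_ler_powR ?nnegrE ?subr_ge0 ?(ltW y0)// (le_trans (ltW y0)).
have ifI : lebesgue_measure.-integrable `]x, x + h] (EFin \o f).
  by apply: integrableS iI => //; apply: subset_itvr; rewrite bnd_simp ltW.
have mI : lebesgue_measure (`]x, x + h]%classic : set R) = h%:E.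
  by rewrite lebesgue_measure_itv/= lte_fin ltrDl h0 -EFinB addrC addKr.
have cI (r : R) :
    lebesgue_measure.-integrable `]x, x + h] (EFin \o (fun _ : R => r)).
  have : lebesgue_measure.-integrable `[x, x + h] (EFin \o (fun _ : R => r)).
    apply: continuous_compact_integrable; first exact: segment_compact.
    by apply: continuous_subspaceT => z; exact: cvg_cst.
  by apply: integrableS => //; exact: subset_itv_oc_cc.
have hE r : r * h = \int[lebesgue_measure]_(y in `]x, x + h]) r.
  by rewrite Rintegral_cst// [X in fine X]mI.
rewrite -/(f x) -/(f (x + h)) !hE; apply/andP; split; apply: le_Rintegral => //.
- move=> y /=; rewrite in_itv/= => /andP[xy yh]; apply: f_le => //.
  exact: lt_trans xy.
- by move=> y /=; rewrite in_itv/= => /andP[xy yh]; apply: f_le => //; exact: ltW.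
Qed.

Lemma continuous_lower_incomplete_gamma_integrand (R : realType) (a x : R) :
  0 < x -> {for x, continuous (fun y : R => expR (- y) * y `^ (a - 1))}.
Proof.
move=> x0; apply: cvgM; last exact: powR_continuous.
apply: continuous_comp; first exact: opp_continuous.
exact: continuous_expR.
Qed.

(** * Elementary inequalities for powers *)

Lemma powR_le_tangent (R : realType) (p a x : R) :
  0 < p -> p <= 1 -> 0 < a -> 0 <= x ->
  x `^ p <= p * a `^ (p - 1) * x + (1 - p) * a `^ p.
Proof.
move=> p0 p1 a0; rewrite le_eqVlt => /predU1P[<-|x0].
  by rewrite powR0 ?gt_eqF// mulr0 add0r mulr_ge0 ?powR_ge0// subr_ge0.
have -> : a `^ (p - 1) = a `^ p / a.
  by rewrite powRB ?powRr1 ?(ltW a0) ?(gt_eqF a0) ?implybT.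
pose r := x / a; have r0 : 0 < r by rewrite divr_gt0.
have -> : x = a * r by rewrite /r mulrC divfK// gt_eqF.
rewrite powRM ?(ltW a0) ?(ltW r0)//.
suff : r `^ p <= p * r + (1 - p).
  move=> /(ler_wpM2l (powR_ge0 a p)) /le_trans; apply.
  rewrite le_eqVlt; apply/orP; left; apply/eqP; field.
  by rewrite gt_eqF.
rewrite /powR gt_eqF//; set m := p * ln r.
(* Both exponentials are bounded below by their tangents at the weighted mean
   [m] of the exponents [ln r] and [0]. *)
have hr : expR m * (1 + (ln r - m)) <= r.
  rewrite [leRHS](_ : _ = expR m * expR (ln r - m)); last first.
    by rewrite -expRD addrC subrK lnK.
  by rewrite ler_wpM2l ?expR_ge0 ?expR_ge1Dx.
have h1 : expR m * (1 - m) <= 1.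
  rewrite [leRHS](_ : _ = expR m * expR (- m)); last by rewrite -expRD subrr expR0.
  by rewrite ler_wpM2l ?expR_ge0 ?expR_ge1Dx.
have -> : expR m = p * (expR m * (1 + (ln r - m))) + (1 - p) * (expR m * (1 - m)).
  by rewrite /m; ring.
by rewrite lerD ?ler_wpM2l ?(ltW p0)// -[leRHS]mulr1 ler_wpM2l// subr_ge0.
Qed.

(** If [b <= x], the first summand suffices; otherwise [expR (e * (b - x)) >= 1] and the second one
    does. *)
Lemma powR_ge_expR (R : realType) (p b e x : R) :
  0 <= p -> 0 <= b -> 0 <= e -> 0 <= x ->
  b `^ p <= x `^ p + b `^ p * expR (e * b) * expR (- e * x).
Proof.
move=> p0 b0 e0 x0; have [bx|xb] := leP b x.
  rewrite (@le_trans _ _ (x `^ p))//; first by rewrite ge0_ler_powR.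
  by rewrite lerDl !mulr_ge0 ?powR_ge0 ?expR_ge0.
rewrite -mulrA -expRD ler_wpDl ?powR_ge0// ler_peMr ?powR_ge0//.
by rewrite -expR0 ler_expR mulNr -mulrBr mulr_ge0// subr_ge0 ltW.
Qed.

(* The rate [e] is chosen so that [e * b - e * k * t <= - d^-1]. *)
Lemma powR_chernoff_ge (R : realType) (p c k t d : R)
    (e := 2 / (d ^+ 2 * c) / t) (b := (1 - d) * (c * t)) :
  0 < p -> p <= 1 -> 0 < c -> 0 < t -> 0 < d -> d < 1 -> c * (1 - d / 2) <= k ->
  (c * t) `^ p * (1 - 2 * d) <= b `^ p * (1 - expR (e * b) * expR (- (t * k * e))).
Proof.
move=> p0 p1 c0 t0 d0 d1 kc.
have ct0 : 0 < c * t by rewrite mulr_gt0.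
have e0 : 0 < e by rewrite !divr_gt0// mulr_gt0// exprn_gt0.
have le_d : expR (e * b) * expR (- (t * k * e)) <= d.
  rewrite -expRD; apply: (@le_trans _ _ (expR (- d^-1))).
    rewrite ler_expR.
    have -> : - d^-1 = e * b - t * (c * (1 - d / 2)) * e.
      by rewrite /e /b; field; rewrite !gt_eqF.
    by rewrite lerD2l lerN2 ler_wpM2r ?(ltW e0)// ler_wpM2l// ltW.
  (* Here [expR (d^-1) >= 1 + d^-1 >= d^-1], and inverses are taken. *)
  rewrite expRN -[leRHS]invrK lef_pV2 ?posrE ?expR_gt0 ?invr_gt0//.
  by rewrite (le_trans _ (expR_ge1Dx _))// lerDr.
rewrite (powRM p (_ : 0 <= 1 - d) (ltW ct0)) ?subr_ge0 ?(ltW d1)//.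
rewrite mulrC [leRHS]mulrAC ler_wpM2r ?powR_ge0//.
have pd : 1 - d <= (1 - d) `^ p.
  by apply: ger1_powR => //; rewrite subr_gt0 d1 gerBl ltW.
(* One factor [1 - d] bounds the power of [1 - d] from below, the other comes from [le_d]; the
   product exceeds [1 - 2 * d] by [d ^+ 2]. *)
apply: (@le_trans _ _ ((1 - d) * (1 - d))); first nra.
by apply: ler_pM; rewrite ?subr_ge0 ?(ltW d1)// lerD2l lerN2.
Qed.

(** * Moment bounds for a nonnegative random variable from its Laplace transform *)

Section nonnegative_random_variable.
Context d (T : measurableType d) (R : realType) (P : probability T R).
Variable X : T -> R.
Hypothesis mX : measurable_fun [set: T] X.
Hypothesis X0 : forall w, 0 <= X w.

Let mL (e : R) : measurable_fun [set: T] (fun w => expR (e * X w)).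
Proof.
apply: measurableT_comp; first exact: measurable_expR.
exact: measurable_funM.
Qed.

Let mXp (p : R) : measurable_fun [set: T] (fun w => X w `^ p).
Proof.
by apply: (measurableT_comp (f := fun x : R => x `^ p)); first exact: measurable_powR.
Qed.

Let mD (e : R) : 0 < e ->
  measurable_fun [set: T] (fun w => X w / (1 + e * X w)).
Proof.
move=> e0; apply: measurable_funM => //.
(* Writing the inverse as a power reduces its measurability to that of [powR]. *)
have -> : (fun w => (1 + e * X w)^-1) = (fun w => (1 + e * X w) `^ (-1)).
  by apply/funext => w; rewrite powR_inv1// addr_ge0// mulr_ge0// ltW.
apply: (measurableT_comp (f := fun x : R => x `^ (-1))).
  exact: measurable_powR.
by apply: measurable_funD => //; exact: measurable_funM.
Qed.

(** Pointwise, [e * x / (1 + e * x) = 1 - (1 + e * x)^-1 <= 1 - expR (- e * x)], because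
    [1 + e * x <= expR (e * x)]; after integration, [1 - expR (- (c * e)) <= c * e]. *)
Lemma expectation_damped_le (c e : R) : 0 < e ->
  ((expR (- (c * e)))%:E <= 'E_P[fun w => expR (- e * X w)%R])%E ->
  ('E_P[fun w => (X w / (1 + e * X w))%R] <= c%:E)%E.
Proof.
move=> e0 hc.
have den (w : T) : 0 < 1 + e * X w by rewrite ltr_pwDl// mulr_ge0// ltW.
have g0 (w : T) : 0 <= X w / (1 + e * X w) by rewrite divr_ge0// ltW.
(* Stated as a sum, the inequality involves only integrals of nonnegative functions, and no
   integrability of [X] has to be known. *)
have : (e%:E * 'E_P[fun w => (X w / (1 + e * X w))%R] +
    'E_P[fun w => expR (- e * X w)%R] <= 1%:E)%E.
  rewrite -(expectation_cst P 1) !unlock -ge0_integralZl//=; last 3 first.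
  - exact/measurable_EFinP/mD.
  - by move=> w _; rewrite lee_fin.
  - by rewrite lee_fin ltW.
  rewrite -ge0_integralD//=; last 3 first.
  - by move=> w _; rewrite -EFinM lee_fin mulr_ge0// ltW.
  - by apply/measurable_EFinP; apply: measurable_funM => //; exact: mD.
  - exact/measurable_EFinP.
  apply: ge0_le_integral => //=.
  - by move=> w _; rewrite -EFinM -EFinD lee_fin addr_ge0 ?expR_ge0// mulr_ge0// ltW.
  - apply/measurable_EFinP/measurable_funD => //.
    by apply: measurable_funM => //; exact: mD.
  - move=> w _; rewrite -EFinM -EFinD lee_fin mulNr expRN mulrA.
    rewrite -lerBrDr; have -> : e * X w / (1 + e * X w) = 1 - (1 + e * X w)^-1.
      by field; rewrite gt_eqF.
    by rewrite lerD2l lerN2 lef_pV2 ?posrE ?expR_gt0 ?expR_ge1Dx.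
move=> h; have : (e%:E * 'E_P[fun w => (X w / (1 + e * X w))%R] +
    (1 - c * e)%:E <= 1%:E)%E.
  apply: le_trans h; rewrite leeD2l//; apply: le_trans hc.
  by rewrite lee_fin expR_ge1Dx.
rewrite -leeBrDr// -EFinB opprB addrC subrK muleC -lee_pdivlMr//.
by rewrite -EFinM mulfK ?gt_eqF.
Qed.

(** Along the rates [harmonic n], which decrease to 0, the damped variables increase to [X], so
    monotone convergence passes their common bound on to [X]. *)
Lemma expectation_le_of_laplace (c : R) :
  (forall e : R, 0 < e ->
    ((expR (- (c * e)))%:E <= 'E_P[fun w => expR (- e * X w)%R])%E) ->
  ('E_P[X] <= c%:E)%E.
Proof.
move=> hL.
pose g n w := (X w / (1 + harmonic n * X w))%:E.
have den n w : 0 < 1 + harmonic n * X w.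
  by rewrite ltr_pwDl// mulr_ge0// harmonic_ge0.
have gX w : g n w @[n --> \oo] --> (X w)%:E.
  apply: cvg_EFin; first exact: nearW.
  rewrite -[X in _ --> X]mulr1 -[X in _ * X]invr1.
  apply: cvgM; first exact: cvg_cst.
  apply: cvgV; first by rewrite oner_eq0.
  rewrite -[X in _ --> X]addr0 -[X in _ + X](mul0r (X w)).
  apply: cvgD; first exact: cvg_cst.
  by apply: cvgM; [exact: cvg_harmonic|exact: cvg_cst].
have Eg : (\int[P]_w g n w @[n --> \oo] --> \int[P]_w (X w)%:E)%E.
  rewrite (_ : (\int[P]_w (X w)%:E = \int[P]_w limn (g ^~ w))%E); last first.
    by apply: eq_integral => w _; apply/esym/cvg_lim => //; exact: gX.
  apply: cvg_monotone_convergence => //.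
  - by move=> n; apply/measurable_EFinP/mD; rewrite invr_gt0.
  - by move=> n w _; rewrite lee_fin divr_ge0// ltW.
  - move=> w _ m n mn; rewrite lee_fin ler_wpM2l// lef_pV2 ?posrE ?den//.
    by rewrite lerD2l ler_wpM2r// lef_pV2 ?posrE// ler_nat.
rewrite unlock -(cvg_lim _ Eg)//; apply: lime_le; first exact: cvgP Eg.
apply: nearW => n; have n0 : 0 < harmonic n :> R by rewrite invr_gt0.
by have := @expectation_damped_le c _ n0 (hL _ n0); rewrite unlock.
Qed.

(** Integrates the tangent inequality; the point of tangency [a] is left free, to be chosen
    according to use. *)
Lemma expectation_powR_le (p a c : R) : 0 < p -> p <= 1 -> 0 < a ->
  ('E_P[X] <= c%:E)%E ->
  ('E_P[fun w => (X w `^ p)%R] <= (p * a `^ (p - 1) * c + (1 - p) * a `^ p)%:E)%E.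
Proof.
move=> p0 p1 a0 hc.
have k0 : 0 <= p * a `^ (p - 1) by rewrite mulr_ge0 ?powR_ge0 ?ltW.
have l0 : 0 <= (1 - p) * a `^ p by rewrite mulr_ge0 ?powR_ge0 ?subr_ge0.
rewrite EFinD EFinM.
apply: (@le_trans _ _ ((p * a `^ (p - 1))%:E * 'E_P[X] + ((1 - p) * a `^ p)%:E)%E).
  rewrite -(expectation_cst P ((1 - p) * a `^ p)) !unlock -ge0_integralZl//=;
    last 2 first.
  - exact/measurable_EFinP.
  - by move=> w _; rewrite lee_fin.
  rewrite -ge0_integralD//=; last 2 first.
  - by move=> w _; rewrite -EFinM lee_fin mulr_ge0.
  - by apply/measurable_EFinP; exact: measurable_funM.
  apply: ge0_le_integral => //=.
  - by move=> w _; rewrite lee_fin powR_ge0.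
  - exact/measurable_EFinP.
  - by apply/measurable_EFinP/measurable_funD => //; exact: measurable_funM.
  - by move=> w _; rewrite -EFinM -EFinD lee_fin powR_le_tangent.
by rewrite leeD2r// lee_wpmul2l// lee_fin.
Qed.

(** Integrates [powR_ge_expR]; a bound on the Laplace transform at the single rate [e] is enough. *)
Lemma expectation_powR_ge (p b e L : R) : 0 <= p -> 0 <= b -> 0 <= e ->
  ('E_P[fun w => expR (- e * X w)%R] <= L%:E)%E ->
  ((b `^ p * (1 - expR (e * b) * L))%:E <= 'E_P[fun w => (X w `^ p)%R])%E.
Proof.
move=> p0 b0 e0 hL.
have k0 : 0 <= b `^ p * expR (e * b) by rewrite mulr_ge0 ?powR_ge0 ?expR_ge0.
have : ((b `^ p)%:E <= 'E_P[fun w => (X w `^ p)%R] +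
    (b `^ p * expR (e * b))%:E * 'E_P[fun w => expR (- e * X w)%R])%E.
  rewrite -(expectation_cst P (b `^ p)) !unlock -ge0_integralZl//=;
    last exact/measurable_EFinP.
  rewrite -ge0_integralD//=; last 4 first.
  - by move=> w _; rewrite lee_fin powR_ge0.
  - exact/measurable_EFinP.
  - by move=> w _; rewrite -EFinM lee_fin mulr_ge0 ?expR_ge0.
  - by apply/measurable_EFinP; exact: measurable_funM.
  apply: ge0_le_integral => //=.
  - by move=> w _; rewrite lee_fin powR_ge0.
  - by apply/measurable_EFinP/measurable_funD => //; exact: measurable_funM.
  - by move=> w _; rewrite -EFinM -EFinD lee_fin powR_ge_expR.
move=> h; have : ((b `^ p)%:E <= 'E_P[fun w => (X w `^ p)%R] +
    (b `^ p * expR (e * b) * L)%:E)%E.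
  apply: (le_trans h).
  by rewrite leeD2l// [in leRHS]EFinM lee_wpmul2l// lee_fin.
by rewrite -leeBlDr// -EFinB mulrBr mulr1 mulrA.
Qed.

End nonnegative_random_variable.

(** * Moments of the TInG subordinator *)

Section TInG.
Context (R : realType) (d : measure_display) (T : measurableType d).
Context (P : probability T R) (alpha theta p : R) (S : R -> {RV P >-> R}).
Hypotheses (alpha0 : 0 < alpha) (alpha1 : alpha <= 1) (theta0 : 0 < theta).
Hypotheses (p0 : 0 < p) (p1 : p <= 1).
Hypothesis TS : TInG_subordinator alpha theta S.

(** The right derivative at 0 of the Laplace exponent. *)
Let c := alpha * expR (- theta) * theta `^ (alpha - 1).
Let f (y : R) := expR (- y) * y `^ (alpha - 1).

Let c0 : 0 < c. Proof. by rewrite !mulr_gt0 ?expR_gt0 ?powR_gt0. Qed.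

Lemma TInG_ae_ge0 (t : R) : 0 <= t -> {ae P, forall w, 0 <= S t w}.
Proof.
case: TS => -[[S0 _ _ _ _] Smono] _ t0.
by apply: filterS2 S0 Smono => w S0w /(_ 0 t (lexx 0) t0); rewrite S0w.
Qed.

(* A version of the process that is nonnegative everywhere. *)
Let Y t w := Order.max (S t w) 0.

Let mY t : measurable_fun [set: T] (Y t).
Proof. by apply: measurable_maxr. Qed.

Let Y0 t w : 0 <= Y t w. Proof. by rewrite le_max lexx orbT. Qed.

(** [S t] and [Y t] agree almost surely. This transfers to [S t] the bounds above, which ask for
    nonnegativity at every point. *)
Let EY (t : R) (g : R -> R) : 0 <= t -> measurable_fun [set: R] g ->
  ('E_P[fun w => g (S t w)] = 'E_P[fun w => g (Y t w)])%E.
Proof.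
move=> t0 mg; rewrite !unlock; apply: ae_eq_integral => //.
- by apply/measurable_EFinP; apply: (measurableT_comp (f := g)).
- by apply/measurable_EFinP; apply: (measurableT_comp (f := g)).
- by apply: filterS (TInG_ae_ge0 t t0) => w S0 _; rewrite /Y max_l.
Qed.

(** The Laplace exponent is [alpha] times the increment of the incomplete gamma function from
    [theta] to [theta + e], which is bracketed by the endpoint values of [f] times [e]. *)
Let laplaceY (t e : R) : 0 <= t -> 0 < e ->
  ((expR (- (c * t * e)))%:E <= 'E_P[fun w => expR (- e * Y t w)%R] <=
   (expR (- (t * (alpha * f (theta + e)) * e)))%:E)%E.
Proof.
move=> t0 e0; case: TS => _ /(_ t e t0 e0).
rewrite (EY t (fun x => expR (- e * x)))//; last first.
  by apply: measurableT_comp; [exact: measurable_expR|exact: measurable_funM].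
move=> ->; rewrite !lee_fin !ler_expR mulNr !lerN2.
have /andP[lo up] :=
  @lower_incomplete_gamma_increment R alpha theta e alpha0 alpha1 theta0 e0.
apply/andP; split.
  rewrite (_ : c * t * e = t * (alpha * (f theta * e))); last by rewrite /c /f; ring.
  by rewrite !ler_wpM2l// ltW.
rewrite (_ : _ * e = t * (alpha * (f (theta + e) * e))); last by ring.
by rewrite !ler_wpM2l// ltW.
Qed.

Let EY_le (t : R) : 0 <= t -> ('E_P[Y t] <= (c * t)%:E)%E.
Proof.
move=> t0; apply: expectation_le_of_laplace => // e e0.
by have /andP[] := laplaceY t e t0 e0.
Qed.

Lemma TInG_moment_le (t : R) : 0 < t ->
  ('E_P[fun w => (S t w `^ p)%R] <= ((c * t) `^ p)%:E)%E.
Proof.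
move=> t0; have ct0 : 0 < c * t by rewrite mulr_gt0.
rewrite (EY t _ (ltW t0) (@measurable_powR R p)).
have := expectation_powR_le _ _ _ _ _ (mY t) (Y0 t) p (c * t) (c * t) p0 p1 ct0
  (EY_le t (ltW t0)).
move=> /le_trans; apply; rewrite lee_fin -mulrA [X in p * X]mulrC.
by rewrite mulr_powRB1 ?(ltW ct0)// -mulrDl addrC subrK mul1r.
Qed.

Lemma TInG_moment_fin_num (t : R) : 0 <= t ->
  'E_P[fun w => (S t w `^ p)%R]%E \is a fin_num.
Proof.
move=> t0; rewrite ge0_fin_numE; last first.
  by apply: expectation_ge0 => w; exact: powR_ge0.
rewrite (EY t _ t0 (@measurable_powR R p)).
(* Tangency at 1, since [c * t] vanishes at [t = 0]; any finite bound will do. *)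
have := expectation_powR_le _ _ _ _ _ (mY t) (Y0 t) p 1 (c * t) p0 p1 ltr01
  (EY_le t t0).
by move=> /le_lt_trans; apply; exact: ltry.
Qed.

Lemma TInG_moment_ge (e : R) : 0 < e -> e < 1 ->
  \forall t \near +oo,
    (((c * t) `^ p * (1 - 2 * e))%:E <= 'E_P[fun w => (S t w `^ p)%R])%E.
Proof.
move=> e0 e1.
(* Continuity of [f] at [theta] costs only a factor [1 - e / 2] within a radius [r]; the rate
   [k / t] falls below [r] for [t] large. *)
have /nbhs_ballP[r /= r0 hr] :
    \forall y \near theta, c * (1 - e / 2) < alpha * f y.
  have cf : alpha * f y @[y --> theta] --> alpha * f theta.
    by apply: cvgMr; exact: continuous_lower_incomplete_gamma_integrand.
  apply: cvgr_gt cf _ _.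
  by rewrite /f mulrA -/c gtr_pMr// gtrBl divr_gt0.
(* Chosen so that [k / t] is the rate used in [powR_chernoff_ge]. *)
pose k := 2 / (e ^+ 2 * c).
have k0 : 0 < k by rewrite divr_gt0// mulr_gt0// exprn_gt0.
near=> t.
have t0 : 0 < t by near: t; exact: nbhs_pinfty_gt.
have kt : k / t < r.
  rewrite ltr_pdivrMr// mulrC -ltr_pdivrMr//.
  by near: t; apply: nbhs_pinfty_gt; rewrite num_real.
have kt0 : 0 < k / t by rewrite divr_gt0.
rewrite (EY t _ (ltW t0) (@measurable_powR R p)).
have /andP[_ LY] := laplaceY t (k / t) (ltW t0) kt0.
have hq : c * (1 - e / 2) <= alpha * f (theta + k / t).
  by apply/ltW/hr; rewrite /ball/= opprD addrA subrr sub0r normrN gtr0_norm.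
have b0 : 0 <= (1 - e) * (c * t) by rewrite mulr_ge0 ?subr_ge0 ?ltW// mulr_gt0.
have := expectation_powR_ge _ _ _ _ _ (mY t) (Y0 t) p _ _ _ (ltW p0) b0 (ltW kt0) LY.
apply: le_trans; rewrite lee_fin.
exact: powR_chernoff_ge p0 p1 c0 t0 e0 e1 hq.
Unshelve. all: by end_near. Qed.

Lemma TInG_moment_asymp :
  asymp_equiv +oo (fun t => 'E_P[fun w => (S t w `^ p)%R]%E)
    (fun t => ((c * t) `^ p)%:E).
Proof.
rewrite /asymp_equiv.
have h0 (t : R) : 0 < t -> 0 < (c * t) `^ p.
  by move=> t0; rewrite powR_gt0// mulr_gt0.
pose r t := fine 'E_P[fun w => (S t w `^ p)%R]%E / (c * t) `^ p.
(* For [t > 0] the denominator is nonzero and the moment finite, so the quotient in [\bar R] is a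
   real one. *)
have rE : \forall t \near +oo, (r t)%:E =
    ('E_P[fun w => (S t w `^ p)%R] / ((c * t) `^ p)%:E)%E.
  near=> t; have t0 : 0 < t by near: t; exact: nbhs_pinfty_gt.
  by rewrite inver gt_eqF ?h0// EFinM fineK// TInG_moment_fin_num// ltW.
apply: cvg_trans (near_eq_cvg rE) _; apply: cvg_EFin; first exact: nearW.
apply/cvgrPdist_le => e e0.
(* The first term makes the error [2 * delta] at most [e], the second ensures [delta < 1]. *)
pose delta := Num.min (e / 2) (1 / 2).
have d0 : 0 < delta by rewrite lt_min !divr_gt0.
have d1 : delta < 1 by rewrite gt_min; apply/orP; right; lra.
have de : 2 * delta <= e by rewrite mulrC -ler_pdivlMr// ge_min lexx.
near=> t; have t0 : 0 < t by near: t; exact: nbhs_pinfty_gt.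
have rt1 : r t <= 1.
  rewrite /r ler_pdivrMr ?h0// mul1r -lee_fin fineK ?TInG_moment_fin_num ?(ltW t0)//.
  exact: TInG_moment_le.
have rtd : 1 - 2 * delta <= r t.
  rewrite /r ler_pdivlMr ?h0// mulrC -lee_fin fineK ?TInG_moment_fin_num ?(ltW t0)//.
  by near: t; exact: TInG_moment_ge.
by rewrite ger0_norm ?subr_ge0// lerBlDr -lerBlDl (le_trans _ rtd)// lerB.
Unshelve. all: by end_near. Qed.

End TInG.

Theorem theorem4p6 (R : realType) (d : measure_display) (T : measurableType d)
    (P : probability T R) (alpha theta p : R) (S : R -> {RV P >-> R}) :
  0 < alpha -> alpha <= 1 -> 0 < theta -> 0 < p -> p <= 1 ->
  TInG_subordinator alpha theta S ->
  [/\ forall t : R, 0 <= t -> expectation_exists P (fun w => S t w `^ p),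
      p < alpha -> forall t : R, 0 <= t ->
        'E_P[fun w => (S t w `^ p)%R]%E \is a fin_num &
      asymp_equiv +oo (fun t => 'E_P[fun w => (S t w `^ p)%R]%E)
        (fun t => ((alpha * expR (- theta) * theta `^ (alpha - 1) * t) `^ p)%:E)].
Proof.
move=> alpha0 alpha1 theta0 p0 p1 TS; split.
- move=> t t0; split.
    by apply: (measurableT_comp (f := fun x : R => x `^ p)); first exact: measurable_powR.
  (* The power is nonnegative, so its negative part has expectation 0. *)
  right; rewrite unlock integral0_eq// => w _; congr EFin.
  by rewrite /funrneg/= max_r// oppr_le0 powR_ge0.
- by move=> _ t; exact: (@TInG_moment_fin_num _ _ _ _ alpha theta).
- exact: (@TInG_moment_asymp _ _ _ _ alpha theta).
Qed.
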